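(* Let $p>2$ be a prime and let $\chi$ be a primitive Dirichlet character mod $p$. (1) If $\chi(-1)=-1$, then $\sum_{n=1}^{p-1}\sigma_{2,\mathbb{1},\overline{\chi}}(n)\sigma_{4,\mathbb{1},\chi}(p-n)(3p-8n)=\frac{p}{2}(B_{5,\overline{\chi}}-B_{3,\chi})$, $\sum_{n=1}^{p-1}\sigma_{4,\mathbb{1},\overline{\chi}}(n)\sigma_{6,\mathbb{1},\chi}(p-n)(5p-12n)=\frac{p}{2}(B_{7,\overline{\chi}}-B_{5,\chi})$, $\sum_{n=1}^{p-1}\sigma_{2,\mathbb{1},\overline{\chi}}(n)\sigma_{8,\mathbb{1},\chi}(p-n)(p-4n)=\frac{p}{6}(B_{9,\overline{\chi}}-B_{3,\chi})$. (2) If $\chi(-1)=1$, then $\sum_{n=1}^{p-1}\sigma_{3,\mathbb{1},\overline{\chi}}(n)\sigma_{7,\mathbb{1},\chi}(p-n)(p-3n)=-\frac{p}{8}(B_{8,\overline{\chi}}-B_{4,\chi})$.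
   Context: For a nontrivial Dirichlet character $\psi$ mod $p$, an integer $k\ge2$ and $m\geq1$, $\sigma_{k-1,\mathbb{1},\psi}(m)=\sum_{d_1,d_2>0,\ d_1d_2=m}\psi(d_2)\,d_1^{k-1}$. For a Dirichlet character $\chi$ mod $D$ the generalized Bernoulli numbers $B_{n,\chi}$ are defined by $\sum_{a=1}^{D}\frac{\chi(a)te^{at}}{e^{Dt}-1}=\sum_{n\geq0}B_{n,\chi}\frac{t^n}{n!}$. *)

(* Defs.v *)
From HB Require Import structures.
From mathcomp Require Import all_boot all_order all_algebra.

Set Implicit Arguments.
Unset Strict Implicit.
Unset Printing Implicit Defensive.

Import Order.TTheory GRing.Theory Num.Theory.
Local Open Scope ring_scope.

(* A Dirichlet character mod D, as a function on the integers vanishing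
   exactly at the integers not coprime to D; chi 1 = 1 follows. *)
Record dirichlet_character (C : nzRingType) (D : nat) (chi : int -> C) : Prop :=
  DirichletCharacter {
    dirichlet_modulus_gt0 : (0 < D)%N;
    dirichlet_periodic : forall n : int, chi (n + D%:Z) = chi n;
    dirichlet_mul : forall m n : int, chi (m * n) = chi m * chi n;
    dirichlet_neq0 : forall n : int, (chi n != 0) = coprimez n D%:Z }.

(* A character mod D is primitive if no character modulo a proper divisor
   of D induces it. *)
Definition primitive_dirichlet_character (C : nzRingType) (D : nat)
    (chi : int -> C) : Prop :=
  dirichlet_character D chi /\
  forall (d : nat) (psi : int -> C),
    (d %| D)%N -> (d < D)%N -> dirichlet_character d psi ->
    ~ (forall n : int, coprimez n D%:Z -> chi n = psi n).

Definition conj_char (C : numClosedFieldType) (chi : int -> C) : int -> C :=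
  fun n => (chi n)^*.

(* sigma e psi m is sigma_{e, 1, psi}(m): e = k - 1 is the exponent of d1, not
   the weight k. *)
Definition sigma (C : nzRingType) (e : nat) (psi : int -> C) (m : nat) : C :=
  \sum_(1 <= d1 < m.+1) \sum_(1 <= d2 < m.+1 | (d1 * d2)%N == m)
     psi d2%:Z * d1%:R ^+ e.

(* A formal power series is its sequence of coefficients. *)
Section PowerSeries.
Variable C : fieldType.
Implicit Types f g : nat -> C.

Definition fps_mul f g : nat -> C :=
  fun n => \sum_(i < n.+1) f i * g (n - i)%N.

(* The first n coefficients of 1 / f, solved for recursively from
   \sum_(i <= m) f (m - i) * g i = (m == 0). *)
Fixpoint fps_inv_seq f (n : nat) : seq C :=
  if n is m.+1 then
    let s := fps_inv_seq f m in
    rcons s (((m == 0%N)%:R - \sum_(i < m) f (m - i)%N * s`_i) / f 0%N)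
  else [::].

Definition fps_inv f : nat -> C := fun n => (fps_inv_seq f n.+1)`_n.

(* e^{a t} *)
Definition fps_exp (a : C) : nat -> C := fun n => a ^+ n / n`!%:R.

Lemma size_fps_inv_seq f n : size (fps_inv_seq f n) = n.
Proof. by elim: n => //= n IHn; rewrite size_rcons IHn. Qed.

Lemma nth_fps_inv_seq f n i : (i < n)%N -> (fps_inv_seq f n)`_i = fps_inv f i.
Proof.
elim: n => // n IHn; rewrite ltnS leq_eqVlt => /predU1P[-> //|lt_in].
by rewrite /= nth_rcons size_fps_inv_seq lt_in IHn.
Qed.

Lemma fps_invE f n :
  fps_inv f n =
    ((n == 0%N)%:R - \sum_(i < n) f (n - i)%N * fps_inv f i) / f 0%N.
Proof.
rewrite {1}/fps_inv /= nth_rcons size_fps_inv_seq ltnn eqxx.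
by under eq_bigr => i _ do rewrite nth_fps_inv_seq //.
Qed.

Lemma fps_mulC f g n : fps_mul f g n = fps_mul g f n.
Proof.
rewrite /fps_mul (reindex_inj rev_ord_inj) /=; apply: eq_bigr => i _.
by rewrite subSS mulrC subKn // -ltnS.
Qed.

Lemma fps_mulV f n : f 0%N != 0 -> fps_mul f (fps_inv f) n = (n == 0%N)%:R.
Proof.
move=> f0; rewrite fps_mulC /fps_mul big_ord_recr /= subnn fps_invE.
rewrite divfK // [X in X + _](_ : _ = \sum_(i < n) f (n - i)%N * fps_inv f i).
  by rewrite addrC subrK.
by apply: eq_bigr => i _; rewrite mulrC.
Qed.

Lemma eq_fps_mul f f' g g' : f =1 f' -> g =1 g' -> fps_mul f g =1 fps_mul f' g'.
Proof. by move=> ff gg n; apply: eq_bigr => i _; rewrite ff gg. Qed.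

Lemma fps_mulA f g h : fps_mul f (fps_mul g h) =1 fps_mul (fps_mul f g) h.
Proof.
move=> n; pose F i j := f j * g (i - j)%N * h (n - i)%N.
rewrite /fps_mul; symmetry.
transitivity (\sum_(0 <= i < n.+1) \sum_(0 <= j < n.+1 | (j <= i)%N) F i j).
  rewrite big_mkord; apply: eq_bigr => i _.
  rewrite mulr_suml -(big_mkord xpredT (fun j => F i j)).
  by rewrite (big_nat_widen _ _ n.+1) // (big_nat_widen _ i.+1 n.+1).
rewrite (exchange_big_dep_nat xpredT) //= big_mkord; apply: eq_bigr => j _.
have le_jn : (j <= n)%N by rewrite -ltnS.
rewrite mulr_sumr -(big_mkord xpredT
  (fun k => f j * (g k * h (n - j - k)%N))).
rewrite -[in LHS]big_filter.
transitivity (\sum_(j <= i < n.+1) F i j).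
  rewrite [RHS](big_nat_widenl _ 0) // big_filter.
  by apply: eq_bigl => i; rewrite andTb.
rewrite -{1}[nat_of_ord j]add0n big_addn subSn //.
by apply: eq_bigr => k _; rewrite /F addnK -subnDA [(j + k)%N]addnC mulrA.
Qed.

Lemma fps_mul1l f : fps_mul (fun n => (n == 0%N)%:R) f =1 f.
Proof.
move=> n; rewrite /fps_mul big_ord_recl /= mul1r subn0 big1 ?addr0 // => i _.
by rewrite mul0r.
Qed.

End PowerSeries.

Section Bernoulli.
Variables (C : numFieldType) (D : nat) (chi : int -> C).

(* \sum_(1 <= a <= D) chi(a) e^{a t} *)
Definition bernoulli_num : nat -> C :=
  fun n => \sum_(1 <= a < D.+1) chi a%:Z * fps_exp a%:R n.

(* (e^{D t} - 1) / t *)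
Definition bernoulli_den : nat -> C := fun n => fps_exp D%:R n.+1.

(* B_{n, chi}; both numerator and denominator of the defining generating
   function are divided by t, so that the denominator is invertible. *)
Definition gen_bernoulli (n : nat) : C :=
  n`!%:R * fps_mul bernoulli_num (fps_inv bernoulli_den) n.

(* (e^{D t} - 1) * \sum_n B_{n, chi} t^n / n! = \sum_a chi(a) t e^{a t} *)
Lemma gen_bernoulli_spec : (0 < D)%N ->
  fps_mul (fun n => fps_exp D%:R n - (n == 0%N)%:R)
          (fun n => gen_bernoulli n / n`!%:R)
  =1 (fun n => if n is m.+1 then
                 \sum_(1 <= a < D.+1) chi a%:Z * fps_exp a%:R m
               else 0).
Proof.
move=> D_gt0 n; set G := (fun n => gen_bernoulli n / n`!%:R).
have factE k : (k`!%:R : C) != 0 by rewrite pnatr_eq0 -lt0n fact_gt0.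
have GE : G =1 fps_mul (fps_inv bernoulli_den) bernoulli_num.
  by move=> k; rewrite /G /gen_bernoulli mulrAC divff // mul1r fps_mulC.
have den0 : bernoulli_den 0%N != 0.
  by rewrite /bernoulli_den /fps_exp expr1 divr1 pnatr_eq0 -lt0n.
have e0 : fps_exp D%:R 0%N - 1 = 0 :> C by rewrite /fps_exp expr0 divr1 subrr.
case: n => [|m].
  by rewrite /fps_mul big_ord_recl big_ord0 /= e0 mul0r addr0.
rewrite /fps_mul big_ord_recl /= e0 mul0r add0r.
transitivity (fps_mul bernoulli_den G m).
  by apply: eq_bigr => i _; rewrite /= /bump /= add1n subr0 subSS.
rewrite (eq_fps_mul (frefl _) GE) fps_mulA.
by rewrite (eq_fps_mul (fun k => fps_mulV k den0) (frefl _)) fps_mul1l.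
Qed.

End Bernoulli.

(* Main.v *)
Require Import Defs.
From mathcomp Require Import all_boot all_order all_algebra.
From mathcomp Require Import reals complex.
From mathcomp Require Import ring zify.

Import Order.TTheory GRing.Theory Num.Theory.
Local Open Scope ring_scope.

(* Expanding the divisor sums turns the left-hand sides into sums over the
   quadruples (a, b, c, d) of positive integers with a b + c d = p, weighted by
   conj(chi(b)) chi(d).  The Euclidean step
     (a, b, c, d) |-> (a - d, b, c + b, d)   if d < a,
                      (a, b + c, c, d - a)   if a < d,
   is a bijection from the quadruples with a <> d to those with b <> c which
   preserves the weight, because d / b = - a / c is unchanged mod p.  The flip
   (a, b, c, d) |-> (d, c, b, a) multiplies the weight by chi(-1) and exchanges
   the two cases.  Hence the sum telescopes as soon as the flip-symmetrised
   summand h is g(q) - g(succ_quad q) for a polynomial g.  Writing F for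
   (a X - d Y)^m (c X + b Y)^n, h is minus the coefficient of X^(w-1) Y in F,
   w = m + n, and g is obtained by replacing X^i Y^(w-i) in F by a palindromic
   sequence of Bernoulli numbers.  That this sequence solves the cocycle
   equation reflects the absence of cusp forms of level 1 and weight w + 2 = 10
   or 14.  The two ends of the telescope, b = c = 1 and a = d = 1, are
   character sums of Bernoulli polynomials. *)

(** * Bernoulli forms and the telescoping polynomial identities *)

(* The Bernoulli numbers B_i, with B_1 = -1/2; junk (0) for even i >= 10. *)
Definition bern {C : fieldType} (i : nat) : C :=
  nth 0 [:: 1; - 2^-1; 6^-1; 0; - 30^-1; 0; 42^-1; 0; - 30^-1] i.

(* y ^ n B_n(x / y) *)
Definition bern_form {C : fieldType} (n : nat) (x y : C) : C :=
  \sum_(0 <= i < n.+1) 'C(n, i)%:R * bern i * y ^+ i * x ^+ (n - i).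

(* The factor m p - (m + n) k of the convolution sums, with p = a b + c d and
   k = a b. *)
Definition bracket {C : fieldType} (m n : nat) (a b c d : C) : C :=
  a ^+ m.-1 * c ^+ n.-1
    * (m%:R * (a * b + c * d) - (m + n)%:R * (a * b)).

Definition telescoping_form {C : fieldType} (m n : nat) (a b c d : C) : C :=
  \sum_(0 <= i < m.+1) \sum_(0 <= j < n.+1)
    'C(m, i)%:R * 'C(n, j)%:R * bern (minn (i + j) (m + n - (i + j)))
      * (a ^+ i * (- d) ^+ (m - i) * c ^+ j * b ^+ (n - j)).

Definition cusp_free_pairs : seq (nat * nat) :=
  [:: (3, 5); (5, 7); (3, 9); (4, 8)]%N.

Ltac eval_binomials :=
  repeat match goal with |- context [binomial ?m ?n] =>
    let v := eval vm_compute in (binomial m n) in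
    change (binomial m n) with v
  end.

(** The flip exchanges X and Y in F up to the sign (-1)^m, which the palindromic coefficients do not
    see otherwise. At (0, x, y, 1) only X^j Y^(w-j) with j <= n occur; there the palindromic
    sequence agrees with B_j, because the odd B_j with j >= 3 vanish and B_8 = B_4. *)
Lemma telescoping_formP (C : numFieldType) (m n : nat) (a b c d x y : C) :
  (m, n) \in cusp_free_pairs ->
  [/\ bracket m n a b c d + (-1) ^+ m * bracket m n d c b a
        = telescoping_form m n a b c d - telescoping_form m n (a - d) b (c + b) d,
      telescoping_form m n d c b a = (-1) ^+ m * telescoping_form m n a b c d,
      telescoping_form m n (y - x) 1 1 x = (-1) ^+ m * bern_form m x y
    & telescoping_form m n 0 x y 1 = (-1) ^+ m * bern_form n x y].
Proof.
rewrite /telescoping_form /bern_form /bracket /bern unlock.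
by rewrite !inE => /or4P[] /eqP[-> ->]; split;
  rewrite /= /minn /=; eval_binomials; field.
Qed.

(** * Generalized Bernoulli numbers as sums of Bernoulli polynomials *)

Section Bernoulli.
Variable C : numFieldType.

(** This recursion certifies the tabulated values. It stops at n = 9 because the default 0 past the
    table is right for B_9 but wrong for B_10. *)
Lemma bern_rec (n : nat) : (n < 10)%N ->
  \sum_(0 <= i < n.+1) 'C(n.+1, i)%:R * bern i = (n == 0%N)%:R :> C.
Proof.
by do 10 (case: n => [_|n];
  first by rewrite unlock /bern /=; eval_binomials; field).
Qed.

(** The inverse series is t / (e^(D t) - 1), that is, 1 / D times the Bernoulli generating series at
    D t; after scaling, [fps_invE] becomes [bern_rec]. *)
Lemma fps_inv_bernoulli_den (D n : nat) : (0 < D)%N -> (n < 10)%N ->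
  fps_inv (bernoulli_den C D) n = bern n * D%:R ^+ n / (n`!%:R * D%:R).
Proof.
move=> D_gt0; have D0 : D%:R != 0 :> C by rewrite pnatr_eq0 -lt0n.
have factn0 k : k`!%:R != 0 :> C by rewrite pnatr_eq0 -lt0n fact_gt0.
elim/ltn_ind: n => n IHn n_lt.
have binE (i : 'I_n) : bernoulli_den C D (n - i) * fps_inv (bernoulli_den C D) i
    = 'C(n.+1, i)%:R * bern i * (D%:R ^+ n / n.+1`!%:R).
  rewrite IHn ?(ltn_trans (ltn_ord i) n_lt) // /bernoulli_den /fps_exp.
  have i_n : (i <= n.+1)%N by rewrite ltnW // ltnS ltnW.
  have i_n' : (i <= n)%N by rewrite ltnW.
  have -> : n.+1`!%:R = 'C(n.+1, i)%:R * (i`!%:R * (n - i).+1`!%:R) :> C.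
    by rewrite -!natrM -(bin_fact i_n) subSn.
  rewrite exprS.
  have -> : D%:R ^+ n = D%:R ^+ (n - i) * D%:R ^+ i :> C by rewrite -exprD subnK.
  have bin0 : 'C(n.+1, i)%:R != 0 :> C by rewrite pnatr_eq0 -lt0n bin_gt0.
  by field; rewrite D0 bin0 !factn0.
rewrite fps_invE; under eq_bigr do rewrite binE.
rewrite -mulr_suml.
have := bern_rec n n_lt.
rewrite big_mkord big_ord_recr /= binSn => /(canRL (addrK _)) ->.
rewrite /bernoulli_den /fps_exp expr1 divr1 factS natrM.
have n0 : n.+1%:R != 0 :> C by rewrite pnatr_eq0.
case: n n_lt n0 {IHn binE} => [|n] n_lt n0 /=; first by rewrite expr0 fact0; field.
by field; rewrite D0 factn0 -natrD pnatr_eq0.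
Qed.

(** The classical B_{n,chi} = D^(n-1) sum_a chi(a) B_n(a / D), cleared of denominators. *)
Lemma gen_bernoulliE (D n : nat) (chi : int -> C) :
  (0 < D)%N -> (n < 10)%N ->
  D%:R * gen_bernoulli D chi n
  = \sum_(1 <= a < D.+1) chi a * bern_form n a%:R D%:R.
Proof.
move=> D_gt0 n_lt; have D0 : D%:R != 0 :> C by rewrite pnatr_eq0 -lt0n.
have factn0 k : k`!%:R != 0 :> C by rewrite pnatr_eq0 -lt0n fact_gt0.
rewrite /gen_bernoulli fps_mulC /fps_mul.
under [RHS]eq_bigr do rewrite /bern_form big_mkord mulr_sumr.
rewrite exchange_big /= !mulr_sumr; apply: eq_bigr => i _.
have i_n : (i <= n)%N by rewrite -ltnS.
rewrite fps_inv_bernoulli_den ?(leq_ltn_trans i_n) // /bernoulli_num !mulr_sumr.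
apply: eq_bigr => a _; rewrite /fps_exp.
have -> : n`!%:R = 'C(n, i)%:R * (i`!%:R * (n - i)`!%:R) :> C.
  by rewrite -!natrM -(bin_fact i_n).
by field; rewrite D0 !factn0.
Qed.

End Bernoulli.

(** * Quadruples and the Euclidean step *)

Notation quad := (nat * nat * nat * nat)%type.

Definition quads (p : nat) : seq quad :=
  [seq q <- [seq (x, d) | x <- [seq (x, c) | x <- [seq (a, b) |
     a <- index_iota 1 p, b <- index_iota 1 p], c <- index_iota 1 p],
     d <- index_iota 1 p]
   | let: (a, b, c, d) := q in a * b + c * d == p]%N.

Definition flip_quad (q : quad) : quad := let: (a, b, c, d) := q in (d, c, b, a).

(** Meant for a <> d only: at a = d the second branch produces a last entry 0. *)
Definition succ_quad (q : quad) : quad :=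
  let: (a, b, c, d) := q in
  if (d < a)%N then (a - d, b, c + b, d)%N else (a, b + c, c, d - a)%N.

Definition pred_quad (q : quad) : quad :=
  let: (a, b, c, d) := q in
  if (b < c)%N then (a + d, b, c - b, d)%N else (a, b - c, c, d + a)%N.

Definition last_quad (q : quad) := let: (a, _, _, d) := q in a == d.
Definition first_quad (q : quad) := let: (_, b, c, _) := q in b == c.

Lemma mem_pairs (T S : eqType) (s : seq T) (t : seq S) (x : T) (y : S) :
  ((x, y) \in [seq (x, y) | x <- s, y <- t]) = (x \in s) && (y \in t).
Proof.
apply/allpairsP/andP => [[[x' y'] /= [xs yt [-> ->]]] //|[xs yt]].
by exists (x, y).
Qed.

(** Positivity and a b + c d = p force every entry below p, so the box loses no solution. *)
Lemma mem_quads (p a b c d : nat) :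
  ((a, b, c, d) \in quads p)
    = [&& 0 < a, 0 < b, 0 < c, 0 < d & a * b + c * d == p]%N.
Proof.
rewrite mem_filter !mem_pairs !mem_index_iota.
by apply/idP/idP => [|H]; first lia; apply/andP; split; nia.
Qed.

Lemma uniq_quads (p : nat) : uniq (quads p).
Proof.
by apply: filter_uniq; do 3! (apply: allpairs_uniq; rewrite ?iota_uniq //;
  last by move=> [? ?] [? ?]).
Qed.

Lemma big_flip_quad (V : nmodType) (p : nat) (G : quad -> V) :
  \sum_(q <- quads p) G (flip_quad q) = \sum_(q <- quads p) G q.
Proof.
rewrite -(big_map flip_quad xpredT G); apply: perm_big.
have flip_quadK : involutive flip_quad by case=> [[[]]].
apply: uniq_perm; rewrite ?map_inj_uniq ?uniq_quads //; first exact: inv_inj.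
move=> q; rewrite -{1}[q]flip_quadK mem_map; last exact: inv_inj.
by case: q => [[[a b] c] d]; rewrite !mem_quads; lia.
Qed.

(** The first branch of the step ends with b < c, the second with c < b; the order of b and c
    therefore tells [pred_quad] which branch to undo. *)
Lemma big_succ_quad (V : nmodType) (p : nat) (G : quad -> V) :
  \sum_(q <- quads p | ~~ last_quad q) G (succ_quad q)
    = \sum_(q <- quads p | ~~ first_quad q) G q.
Proof.
have uniq_filter P : uniq [seq q <- quads p | P q].
  exact: filter_uniq (uniq_quads p).
have succ_quadK :
    {in [seq q <- quads p | ~~ last_quad q], cancel succ_quad pred_quad}.
  move=> [[[a b] c] d]; rewrite mem_filter mem_quads /= => H.
  by case: ltnP => ? /=; case: ltnP => ?; congr (_, _, _, _); lia.
rewrite -big_filter -[RHS]big_filter -(big_map succ_quad xpredT G).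
apply: perm_big; apply: uniq_perm => //.
  by rewrite map_inj_in_uniq => // x y xs ys /(can_in_inj succ_quadK xs ys).
move=> [[[a b] c] d]; rewrite mem_filter mem_quads /=.
apply/mapP/idP => [[[[[a' b'] c'] d']]|].
  rewrite mem_filter mem_quads /= => H.
  by case: ltnP => le_da [-> -> -> ->]; nia.
move=> H; exists (pred_quad (a, b, c, d)) => /=.
  by case: ltnP => ?; rewrite mem_filter mem_quads /=; nia.
by case: ltnP => ? /=; case: ltnP => ?; congr (_, _, _, _); lia.
Qed.

Lemma prime_mul_gt1 (p m n : nat) :
  prime p -> (m * n)%N = p -> (1 < n)%N -> m = 1%N.
Proof.
move=> p_prime mn_p n_gt1; case: (eqVneq m 1%N) => // m_neq1.
have m_dvd : (m %| p)%N by rewrite -mn_p dvdn_mulr.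
have p_gt0 := prime_gt0 p_prime.
by move/(prime_nt_dvdP p_prime m_neq1): m_dvd; nia.
Qed.

(** If b = c then p = b (a + d) with a + d > 1, so b = 1 by primality. *)
Lemma big_first_quads (V : nmodType) (p : nat) (G : quad -> V) :
  prime p ->
  \sum_(q <- quads p | first_quad q) G q
    = \sum_(1 <= d < p) G ((p - d)%N, 1%N, 1%N, d).
Proof.
move=> p_prime.
rewrite -big_filter -(big_map (fun d => ((p - d)%N, 1%N, 1%N, d)) xpredT G).
apply: perm_big; apply: uniq_perm.
- by rewrite filter_uniq ?uniq_quads.
- by rewrite map_inj_uniq ?iota_uniq // => ? ? [].
move=> [[[a b] c] d]; rewrite mem_filter mem_quads /=.
apply/idP/mapP => [|[d']]; rewrite ?mem_index_iota.
  case/andP=> /eqP <- H.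
  have b1 : b = 1%N by apply: (@prime_mul_gt1 p b (a + d)) => //; nia.
  by subst b; exists d; rewrite ?mem_index_iota; [lia|congr (_, _, _, _); lia].
by move=> H [-> -> -> ->]; lia.
Qed.

Lemma big_last_quads (V : nmodType) (p : nat) (G : quad -> V) :
  prime p ->
  \sum_(q <- quads p | last_quad q) G q
    = \sum_(1 <= b < p) G (1%N, b, (p - b)%N, 1%N).
Proof.
move=> p_prime.
rewrite -big_filter -(big_map (fun b => (1%N, b, (p - b)%N, 1%N)) xpredT G).
apply: perm_big; apply: uniq_perm.
- by rewrite filter_uniq ?uniq_quads.
- by rewrite map_inj_uniq ?iota_uniq // => ? ? [].
move=> [[[a b] c] d]; rewrite mem_filter mem_quads /=.
apply/idP/mapP => [|[b']]; rewrite ?mem_index_iota.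
  case/andP=> /eqP <- H.
  have a1 : a = 1%N by apply: (@prime_mul_gt1 p a (b + c)) => //; nia.
  by subst a; exists b; rewrite ?mem_index_iota; [lia|congr (_, _, _, _); lia].
by move=> H [-> -> -> ->]; lia.
Qed.

(** * Characters mod p and the weights of quadruples *)

Section Character.
Variables (C : numClosedFieldType) (p : nat) (chi : int -> C).
Hypotheses (p_prime : prime p) (chi_char : dirichlet_character p chi).

Lemma char_neq0 (n : nat) : (0 < n < p)%N -> chi n != 0.
Proof.
move=> n_lt; rewrite (dirichlet_neq0 chi_char) coprimezE /= coprime_sym.
by rewrite prime_coprime // gtnNdvd //; lia.
Qed.

Lemma char_modulus : chi p = 0.
Proof.
apply/eqP; rewrite -[_ == 0]negbK (dirichlet_neq0 chi_char) coprimezE /=.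
by rewrite /coprime gcdnn; case: p p_prime => [|[]].
Qed.

Lemma char1 : chi 1 = 1.
Proof.
have chi1_neq0 : chi 1 != 0 by apply: (char_neq0 1); rewrite prime_gt1.
by apply: (mulfI chi1_neq0); rewrite -(dirichlet_mul chi_char) !mulr1.
Qed.

Lemma char_exp (n : int) (k : nat) : chi (n ^+ k) = chi n ^+ k.
Proof.
elim: k => [|k IHk]; first by rewrite !expr0 char1.
by rewrite !exprS (dirichlet_mul chi_char) IHk.
Qed.

Lemma char_addMn (n : int) (k : nat) : chi (n + (k * p)%N) = chi n.
Proof.
elim: k => [|k IHk]; first by rewrite mul0n addr0.
by rewrite mulSn addnC PoszD addrA (dirichlet_periodic chi_char).
Qed.

Lemma char_modn (n : nat) : chi (n %% p)%N = chi n.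
Proof. by rewrite {2}(divn_eq n p) addnC PoszD char_addMn. Qed.

(** By Fermat chi(n)^p = chi(n^p) = chi(n), so chi(n) is a root of unity. *)
Lemma norm_char (n : nat) : (0 < n < p)%N -> `|chi n| = 1.
Proof.
move=> n_lt; have chi_n := char_neq0 n n_lt.
have : chi n ^+ p = chi n.
  rewrite -char_exp -[RHS]char_modn -(fermat_little n) // char_modn.
  by congr chi; rewrite -[RHS]natz natrX natz.
case: p p_prime => [|[|q]] // _ chi_nE.
have chi_n1 : chi n ^+ q.+1 = 1.
  by apply: (mulfI chi_n); rewrite -exprS mulr1.
by apply/eqP; rewrite -(@pexpr_eq1 _ _ q.+1) // -normrX chi_n1 normr1.
Qed.

Lemma mul_conj_char (n : nat) : (0 < n < p)%N -> conj_char chi n * chi n = 1.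
Proof. by move=> n_lt; rewrite /conj_char mulrC -normCK norm_char // expr1n. Qed.

Definition weight (q : quad) : C :=
  let: (_, b, _, d) := q in conj_char chi b * chi d.

Lemma weight_succ_quad (q : quad) : q \in quads p -> ~~ last_quad q ->
  weight (succ_quad q) = weight q.
Proof.
case: q => [[[a b] c] d]; rewrite mem_quads /= => H a_neq_d.
case: ltnP => // le_ad; rewrite /weight.
have b_lt : (0 < b < p)%N by nia.
have bc_lt : (0 < b + c < p)%N by nia.
(* The arguments differ by the period: b (d - a) + p = (b + c) d. *)
have e : chi b * chi (d - a)%N = chi (b + c)%N * chi d.
  rewrite -!(dirichlet_mul chi_char) -[LHS](dirichlet_periodic chi_char).
  congr chi; nia.
transitivity ((conj_char chi (b + c)%N * conj_char chi b)
   * (chi b * chi (d - a)%N)).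
  by rewrite -[LHS]mul1r -{1}(mul_conj_char b) //; ring.
rewrite e -[RHS]mul1r -{1}(mul_conj_char (b + c)) //; ring.
Qed.

Lemma weight_flip_quad (q : quad) : q \in quads p ->
  weight (flip_quad q) = chi (-1) * weight q.
Proof.
case: q => [[[a b] c] d]; rewrite mem_quads /= => H; rewrite /weight.
have b_lt : (0 < b < p)%N by nia.
have c_lt : (0 < c < p)%N by nia.
(* Here a b = - c d + p. *)
have e : chi b * chi a = chi (-1) * (chi c * chi d).
  rewrite -!(dirichlet_mul chi_char) mulN1r -[RHS](dirichlet_periodic chi_char).
  congr chi; nia.
transitivity ((conj_char chi b * conj_char chi c) * (chi b * chi a)).
  by rewrite -[LHS]mul1r -{1}(mul_conj_char b) //; ring.
by rewrite e -[chi (-1) * _ in RHS]mul1r -{1}(mul_conj_char c) //; ring.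
Qed.

(** * The telescoping sum over quadruples *)

Definition quad_eval (g : C -> C -> C -> C -> C) (q : quad) : C :=
  let: (a, b, c, d) := q in g a%:R b%:R c%:R d%:R.

(** Averaging over the flip gives the factor 1/2 and the symmetrised summand. By [big_succ_quad] the
    differences of [g] then cancel along the Euclidean chains, up to their ends. *)
Lemma weighted_quad_sum (h g : C -> C -> C -> C -> C) :
  (forall a b c d, h a b c d + chi (-1) * h d c b a
                   = g a b c d - g (a - d) b (c + b) d) ->
  (forall a b c d, g d c b a = chi (-1) * g a b c d) ->
  \sum_(q <- quads p) weight q * quad_eval h q
    = (\sum_(1 <= d < p) chi d * g (p - d)%:R 1 1 d%:R
       - \sum_(1 <= b < p) conj_char chi b * g 0 b%:R p%:R 1) / 2.
Proof.
move=> hE gE; have sgn2 : chi (-1) * chi (-1) = 1.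
  by rewrite -(dirichlet_mul chi_char) mulN1r opprK char1.
have stepE q : q \in quads p -> ~~ last_quad q ->
    weight q * (quad_eval h q + chi (-1) * quad_eval h (flip_quad q))
    = weight q * quad_eval g q - weight (succ_quad q) * quad_eval g (succ_quad q).
  move=> q_in q_last; rewrite weight_succ_quad // -mulrBr; congr (_ * _).
  case: q q_in q_last => [[[a b] c] d] /= _ a_neq_d.
  case: ltnP => le_ad /=; first by rewrite hE natrB ?natrD // ltnW.
  rewrite natrB // natrD.
  (* For a < d the step is the flip of the first branch: [hE] is applied at (d, c, b, a) and [gE]
     flips the result back. *)
  transitivity (chi (-1) * (h d%:R c%:R b%:R a%:R
     + chi (-1) * h a%:R b%:R c%:R d%:R)).
    by rewrite mulrDr mulrA sgn2 mul1r addrC.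
  by rewrite hE mulrBr -!gE.
apply: (mulIf (x := 2)); rewrite ?pnatr_eq0 // divfK ?pnatr_eq0 //.
rewrite mulr_natr mulr2n -[X in _ + X]big_flip_quad -big_split /=.
transitivity (\sum_(q <- quads p)
   weight q * (quad_eval h q + chi (-1) * quad_eval h (flip_quad q))).
  apply: eq_big_seq => q q_in; rewrite weight_flip_quad //; ring.
pose A q := weight q * quad_eval g q.
(* As an identity in the field, [hE] also holds at a = d = 1; its second term is taken at (0, b, p,
   1), outside the quadruples, and survives as a boundary term. *)
have lastE : \sum_(q <- quads p | last_quad q)
    weight q * (quad_eval h q + chi (-1) * quad_eval h (flip_quad q))
    = \sum_(q <- quads p | last_quad q) A q
      - \sum_(1 <= b < p) conj_char chi b * g 0 b%:R p%:R 1.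
  rewrite !big_last_quads // -sumrB; apply: eq_big_nat => b b_lt.
  rewrite /A /= hE char1 subrr mulr1 -natrD subnK; last by lia.
  ring.
have stepsE : \sum_(q <- quads p | ~~ last_quad q)
    weight q * (quad_eval h q + chi (-1) * quad_eval h (flip_quad q))
    = \sum_(q <- quads p | ~~ last_quad q) A q
      - \sum_(q <- quads p | ~~ first_quad q) A q.
  rewrite -big_succ_quad -sumrB big_seq_cond [RHS]big_seq_cond.
  by apply: eq_bigr => q /andP[]; apply: stepE.
have firstE : \sum_(q <- quads p | first_quad q) A q
    = \sum_(1 <= d < p) chi d * g (p - d)%:R 1 1 d%:R.
  rewrite big_first_quads //; apply: eq_big_nat => d d_lt.
  by rewrite /A /= /conj_char char1 rmorph1 mul1r.
have balance : \sum_(q <- quads p | last_quad q) A q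
      + \sum_(q <- quads p | ~~ last_quad q) A q
    = \sum_(q <- quads p | first_quad q) A q
      + \sum_(q <- quads p | ~~ first_quad q) A q.
  by transitivity (\sum_(q <- quads p) A q);
    [rewrite [RHS](bigID last_quad)|rewrite [LHS](bigID first_quad)].
rewrite (bigID last_quad) /= lastE stepsE -firstE addrACA balance; ring.
Qed.

(** * Convolution sums in terms of quadruples and Bernoulli numbers *)

Lemma sigma_widen (e : nat) (psi : int -> C) (N n : nat) :
  (0 < n < N)%N ->
  sigma e psi n = \sum_(1 <= a < N) \sum_(1 <= b < N | (a * b == n)%N)
                    psi b * a%:R ^+ e.
Proof.
move=> n_lt; rewrite /sigma.
rewrite (big_nat_widen _ n.+1 N) /=; last by lia.
rewrite big_mkcond; apply: eq_big_nat => a a_lt.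
case: ltnP => a_n.
  rewrite (big_nat_widen _ n.+1 N) /=; last by lia.
  rewrite big_nat_cond [RHS]big_nat_cond; apply: eq_bigl => b; nia.
by rewrite big_nat_cond big_pred0 // => b; nia.
Qed.

Lemma big_quads (V : nmodType) (G : quad -> V) :
  \sum_(q <- quads p) G q =
    \sum_(1 <= a < p) \sum_(1 <= b < p) \sum_(1 <= c < p)
      \sum_(1 <= d < p | (a * b + c * d == p)%N) G (a, b, c, d).
Proof.
rewrite /quads big_filter big_mkcond !big_allpairs /=.
do 3! apply: eq_bigr => ? _.
by rewrite -big_mkcond.
Qed.

(** With the sum over k moved innermost, a b = k and c d = p - k leave the single term k = a b, and
    only when a b + c d = p. *)
Lemma convolution_quads (m n : nat) :
  \sum_(1 <= k < p) sigma m.-1 (conj_char chi) k * sigma n.-1 chi (p - k)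
      * (m%:R * p%:R - (m + n)%:R * k%:R)
  = \sum_(q <- quads p) weight q * quad_eval (bracket m n) q.
Proof.
rewrite big_quads.
transitivity (\sum_(1 <= k < p) \sum_(1 <= a < p) \sum_(1 <= b < p)
  \sum_(1 <= c < p) \sum_(1 <= d < p)
    if ((a * b == k) && (c * d == p - k))%N then
      conj_char chi b * a%:R ^+ m.-1 * (chi d * c%:R ^+ n.-1)
        * (m%:R * p%:R - (m + n)%:R * k%:R)
    else 0).
  apply: eq_big_nat => k k_lt.
  rewrite !(@sigma_widen _ _ p) //; last by lia.
  rewrite !mulr_suml; apply: eq_bigr => a _.
  rewrite !mulr_suml big_mkcond; apply: eq_bigr => b _.
  case: ifP => _; last by rewrite big1 // => c _; rewrite big1.
  rewrite mulr_sumr mulr_suml; apply: eq_bigr => c _.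
  by rewrite mulr_sumr mulr_suml big_mkcond.
rewrite exchange_big; apply: eq_big_nat => a a_lt.
rewrite exchange_big; apply: eq_big_nat => b b_lt.
rewrite exchange_big; apply: eq_big_nat => c c_lt.
rewrite exchange_big [RHS]big_mkcond; apply: eq_big_nat => d d_lt /=.
case: eqP => [abcd_p|abcd_p]; last first.
  by rewrite big_nat big1 // => k k_lt; case: ifP => //; nia.
rewrite -big_mkcond big_nat_cond.
rewrite (eq_bigl (fun k => (1 <= k < p) && (k == a * b)))%N.
  rewrite -big_nat_cond big_nat1_eq ifT; last by nia.
  by rewrite /= /bracket -abcd_p natrD !natrM; ring.
by move=> k; nia.
Qed.

Lemma sum_bern_form (psi : int -> C) (n : nat) : psi p = 0 -> (n < 10)%N ->
  \sum_(1 <= a < p) psi a * bern_form n a%:R p%:R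
    = p%:R * gen_bernoulli p psi n.
Proof.
move=> psi_p n_lt; have p_gt0 := prime_gt0 p_prime.
by rewrite gen_bernoulliE // big_nat_recr //= psi_p mul0r addr0.
Qed.

(** The end b = c = 1 gives B_{m,chi} and the end a = d = 1 gives B_n of the conjugate. The parity
    of chi matches the sign of the flip on weights with that on [telescoping_form]. *)
Lemma convolution_bernoulli (m n : nat) :
  (m, n) \in cusp_free_pairs -> chi (-1) = (-1) ^+ m ->
  \sum_(1 <= k < p) sigma m.-1 (conj_char chi) k * sigma n.-1 chi (p - k)
      * (m%:R * p%:R - (m + n)%:R * k%:R)
  = (-1) ^+ m * (p%:R / 2)
      * (gen_bernoulli p chi m - gen_bernoulli p (conj_char chi) n).
Proof.
move=> mn sgn.
have [m_lt n_lt] : (m < 10)%N /\ (n < 10)%N.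
  by move: mn; rewrite !inE => /or4P[] /eqP[-> ->].
have formP a b c d x y := @telescoping_formP C m n a b c d x y mn.
rewrite convolution_quads (@weighted_quad_sum _ (telescoping_form m n)).
- under eq_big_nat => d d_lt.
    (* The zeros are fillers: the selected identity involves only x and y. *)
    have [_ _ e _] := formP 0 0 0 0 d%:R p%:R.
    rewrite natrB ?e; last by lia.
    rewrite mulrCA; over.
  under [X in _ - X]eq_big_nat => b b_lt.
    have [_ _ _ e] := formP 0 0 0 0 b%:R p%:R.
    rewrite e mulrCA; over.
  have conj_p : conj_char chi p = 0 by rewrite /conj_char char_modulus rmorph0.
  rewrite -!mulr_sumr (sum_bern_form _ _ char_modulus m_lt).
  by rewrite (sum_bern_form _ _ conj_p n_lt); field.
- by move=> a b c d; rewrite sgn; case: (formP a b c d 0 0).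
- by move=> a b c d; rewrite sgn; case: (formP a b c d 0 0).
Qed.

End Character.

Theorem theorem5p2 (R : realType) (p : nat) (chi : int -> complex R)
    (p_gt2 : (2 < p)%N) (p_prime : prime p)
    (chi_prim : primitive_dirichlet_character p chi) :
  (chi (-1) = -1 ->
    [/\ \sum_(1 <= n < p)
          sigma 2 (conj_char chi) n * sigma 4 chi (p - n)
            * (3 * p%:R - 8 * n%:R)
        = p%:R / 2 * (gen_bernoulli p (conj_char chi) 5
                      - gen_bernoulli p chi 3),
        \sum_(1 <= n < p)
          sigma 4 (conj_char chi) n * sigma 6 chi (p - n)
            * (5 * p%:R - 12 * n%:R)
        = p%:R / 2 * (gen_bernoulli p (conj_char chi) 7
                      - gen_bernoulli p chi 5)
      & \sum_(1 <= n < p)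
          sigma 2 (conj_char chi) n * sigma 8 chi (p - n)
            * (p%:R - 4 * n%:R)
        = p%:R / 6 * (gen_bernoulli p (conj_char chi) 9
                      - gen_bernoulli p chi 3)]) /\
  (chi (-1) = 1 ->
    \sum_(1 <= n < p)
      sigma 3 (conj_char chi) n * sigma 7 chi (p - n)
        * (p%:R - 3 * n%:R)
    = - (p%:R / 8) * (gen_bernoulli p (conj_char chi) 8
                      - gen_bernoulli p chi 4)).
Proof.
have [chi_char _] := chi_prim.
have eval := @convolution_bernoulli _ p chi p_prime chi_char.
split=> sgn.
- have sgn_odd k : odd k -> chi (-1) = (-1) ^+ k.
    by rewrite sgn -signr_odd => ->.
  split.
  + transitivity ((-1) ^+ 3 * (p%:R / 2)
        * (gen_bernoulli p chi 3 - gen_bernoulli p (conj_char chi) 5)).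
      exact: (eval 3 5 isT (sgn_odd 3 isT)).
    by move: (gen_bernoulli _ _ 3) (gen_bernoulli _ _ 5) => x y; field.
  + transitivity ((-1) ^+ 5 * (p%:R / 2)
        * (gen_bernoulli p chi 5 - gen_bernoulli p (conj_char chi) 7)).
      exact: (eval 5 7 isT (sgn_odd 5 isT)).
    by move: (gen_bernoulli _ _ 5) (gen_bernoulli _ _ 7) => x y; field.
  (* The general factor is 3 p - 12 k = 3 (p - 4 k), hence 3^-1. *)
  + transitivity (3^-1 * ((-1) ^+ 3 * (p%:R / 2)
        * (gen_bernoulli p chi 3 - gen_bernoulli p (conj_char chi) 9))).
      rewrite -(eval 3 9 isT (sgn_odd 3 isT)) mulr_sumr; apply: eq_bigr => k _ /=.
      by rewrite -[(3 + 9)%N]/12%N; field.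
    by move: (gen_bernoulli _ _ 3) (gen_bernoulli _ _ 9) => x y; field.
have sgn4 : chi (-1) = (-1) ^+ 4 by rewrite -signr_odd.
(* Likewise 4 p - 12 k = 4 (p - 3 k). *)
transitivity (4^-1 * ((-1) ^+ 4 * (p%:R / 2)
    * (gen_bernoulli p chi 4 - gen_bernoulli p (conj_char chi) 8))).
  rewrite -(eval 4 8 isT sgn4) mulr_sumr; apply: eq_bigr => k _ /=.
  by rewrite -[(4 + 8)%N]/12%N; field.
by move: (gen_bernoulli _ _ 4) (gen_bernoulli _ _ 8) => x y; field.
Qed.
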